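(* Let $R$ be a commutative unital ring and $A\in \mathbb{M}_{2}(R)$. Then $A$ has left stable range 1 in $\mathbb{M}_2(R)$ if and only if for every $X\in \mathbb{M}_{2}(R)$ there exists $Y\in \mathbb{M}_{2}(R)$ such that $$\det (Y)\bigl(\det (X)\det (A)-\mathrm{Tr}(XA)+1\bigr)+\det (A)\bigl(\mathrm{Tr}(XY)+1\bigr)-\mathrm{Tr}(A\,\mathrm{adj}(Y))$$ is a unit of $R$.
   Context: An element $a$ of a unital ring $S$ has left stable range 1 if whenever $Sa+Sb=S$ for some $b\in S$, there is an element $y\in S$ such that $a+yb\in U(S)$, where $U(S)$ is the group of units of $S$. Equivalently, for every $x\in S$ there is $y\in S$ such that $a+y(xa-1)\in U(S)$. $\mathbb{M}_2(R)$ is the ring of $2\times 2$ matrices over $R$, $\mathrm{Tr}$ is the trace, and $\mathrm{adj}(Y)$ is the classical adjoint (adjugate) of $Y$. *)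

(* Defs.v *)
From HB Require Import structures.
From mathcomp Require Import all_boot all_order all_algebra.

Set Implicit Arguments.
Unset Strict Implicit.
Unset Printing Implicit Defensive.

Import GRing.Theory.
Local Open Scope ring_scope.

(* [GRing.unit] needs a [unitRingType], i.e. a nonzero ring with a decidable
   unit predicate; this version makes sense in every unital ring, the zero
   ring included. *)
Definition is_unit (S : pzRingType) (u : S) : Prop :=
  exists v : S, u * v = 1 /\ v * u = 1.

Lemma is_unitE (S : unitRingType) (u : S) : is_unit u <-> u \is a GRing.unit.
Proof.
by split=> [[v [uv vu]] | /unitrP[v [vu uv]]]; [apply/unitrP|]; exists v.
Qed.

(* The equality of left ideals S a + S b = S. *)
Definition left_comaximal (S : pzRingType) (a b : S) : Prop :=
  forall s : S, exists u v : S, s = u * a + v * b.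

Definition left_stable_range1 (S : pzRingType) (a : S) : Prop :=
  forall b : S, left_comaximal a b -> exists y : S, is_unit (a + y * b).

(* Main.v *)
Require Import Defs.
From HB Require Import structures.
From mathcomp Require Import all_boot all_order all_algebra.
From mathcomp Require Import ring.

Set Implicit Arguments.
Unset Strict Implicit.
Unset Printing Implicit Defensive.

Import GRing.Theory.
Local Open Scope ring_scope.

(** The comaximal pairs (A, B) reduce to those with B = XA - 1: if
    1 = UA + VB, then UA - 1 = - VB is a left multiple of B, and a unit of
    the form A + Y(UA - 1) is also one of the form A + Y'B
    ([left_stable_range1_subr1P]).  So the question is when A + Y(XA - 1) is
    invertible, which for a matrix over a commutative ring means that its
    determinant is a unit ([is_unit_detP]).  The polarization identity
    det(A + B) = det A + det B + Tr(A adj B) for 2 x 2 matrices, applied to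
    B = Y(XA - 1), turns this determinant into the expression of the theorem
    ([det_addM_subr1]): the term det B factors as det Y det(XA - 1), and
    A adj(B) = A (adj A adj X - 1) adj Y = det A adj(YX) - A adj(Y), where
    adj(YX) has the trace of YX, that is Tr(XY). *)

(** One implication is the instance b = x a - 1, which is comaximal with a
    because x a - (x a - 1) = 1; for the other, x is the coefficient of a in
    a decomposition of 1. *)
Lemma left_stable_range1_subr1P (S : pzRingType) (a : S) :
  left_stable_range1 a <-> forall x, exists y, is_unit (a + y * (x * a - 1)).
Proof.
split=> [sr1_a x | sr1_a b comax_ab].
  apply: sr1_a => s; exists (s * x), (- s).
  by rewrite mulNr mulrBr mulr1 mulrA opprB addrC subrK.
(* Since v b = 1 - x a, the element y (x a - 1) is - (y v) b. *)
have [x [v def1]] := comax_ab 1.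
have [y unit_y] := sr1_a x; exists (- (y * v)).
suff <- : y * (x * a - 1) = - (y * v) * b by [].
by rewrite def1 opprD addrA subrr add0r mulrN mulNr mulrA.
Qed.

(** The determinant is multiplicative, and conversely the adjugate is an
    inverse up to the factor det M. *)
Lemma is_unit_detP (R : comPzRingType) n (M : 'M[R]_n) :
  is_unit M <-> is_unit (\det M).
Proof.
split=> [[N [MN NM]] | [d [Md dM]]].
  by exists (\det N); rewrite -!det_mulmx [M *m N]MN [N *m M]NM det1.
exists (d *: \adj M); split.
  by rewrite -[LHS]scalemxAr mul_mx_adj scale_scalar_mx dM.
by rewrite -[LHS]scalemxAl mul_adj_mx scale_scalar_mx dM.
Qed.

Lemma forall_ord2 (P : 'I_2 -> Prop) : P 0 -> P 1 -> forall i, P i.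
Proof.
by move=> P0 P1 [[|[|//]] lt_i2]; [move: P0 | move: P1];
   congr (P _); apply: val_inj.
Qed.

Lemma lift0_ord2 : lift 0 0 = 1 :> 'I_2. Proof. exact: val_inj. Qed.

Lemma lift1_ord2 : lift 1 0 = 0 :> 'I_2. Proof. exact: val_inj. Qed.

Lemma sum_ord2 (V : nmodType) (F : 'I_2 -> V) : \sum_i F i = F 0 + F 1.
Proof. by rewrite !big_ord_recl big_ord0 addr0 lift0_ord2. Qed.

Section Matrix2.

Variable R : comPzRingType.
Implicit Types M N A B X Y : 'M[R]_2.

Lemma det_mx2 M : \det M = M 0 0 * M 1 1 - M 0 1 * M 1 0.
Proof.
rewrite (expand_det_row _ 0) sum_ord2 /cofactor !det_mx11 !mxE.
by rewrite lift0_ord2 lift1_ord2 expr0 expr1; ring.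
Qed.

(** This is the Cayley-Hamilton theorem in size 2, divided by M; it shows
    that the adjugate is additive in this size. *)
Lemma adj_mx2 M : \adj M = (\tr M)%:M - M.
Proof.
apply/matrixP=> i j; rewrite /mxtrace sum_ord2 !mxE /cofactor det_mx11 !mxE.
move: i j; do 2!apply: forall_ord2; rewrite ?lift0_ord2 ?lift1_ord2 /=.
all: rewrite ?mulr1n ?mulr0n ?expr0 ?expr1 ?expr2.
all: by ring.
Qed.

Lemma adjB_mx2 M N : \adj (M - N) = \adj M - \adj N.
Proof. by rewrite !adj_mx2 !raddfB addrACA. Qed.

Lemma mxtrace_adj_mx2 M : \tr (\adj M) = \tr M.
Proof. by rewrite adj_mx2 raddfB /= mxtrace_scalar mulr2n addrK. Qed.

Lemma adjM_mx2 M N : \adj (M *m N) = \adj N *m \adj M.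
Proof.
rewrite !adj_mx2 /mxtrace !sum_ord2; apply/matrixP=> i j.
rewrite !mxE !sum_ord2 !mxE.
move: i j; do 2!apply: forall_ord2; rewrite /= ?mulr1n ?mulr0n.
all: by ring.
Qed.

(** The polarization of the determinant, a quadratic form in this size: its
    polar form is (M, N) |-> Tr(M adj N). *)
Lemma detD_mx2 M N : \det (M + N) = \det M + \det N + \tr (M *m \adj N).
Proof.
rewrite !det_mx2 adj_mx2 /mxtrace !sum_ord2 !mxE !sum_ord2 !mxE /=.
by rewrite ?mulr1n ?mulr0n; ring.
Qed.

(** Polarization is used twice, for det(XA - 1) and for the sum itself; the
    quartic part of the cross term collapses because A adj A is the scalar
    matrix det A, leaving det A Tr(XY). *)
Lemma det_addM_subr1 A X Y :
  \det (A + Y *m (X *m A - 1%:M)) =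
    \det Y * (\det X * \det A - \tr (X *m A) + 1)
    + \det A * (\tr (X *m Y) + 1) - \tr (A *m \adj Y).
Proof.
have detXA1 : \det (X *m A - 1%:M) = \det X * \det A - \tr (X *m A) + 1.
  rewrite addrC -(raddfN (@scalar_mx R 2)) detD_mx2 det_scalar sqrrN expr1n det_mulmx.
  by rewrite mul_scalar_mx scaleN1r raddfN /= mxtrace_adj_mx2; ring.
have trA : \tr (A *m \adj (Y *m (X *m A - 1%:M))) =
    \det A * \tr (X *m Y) - \tr (A *m \adj Y).
  rewrite adjM_mx2 adjB_mx2 adj1 adjM_mx2 mulmxA mulmxBr mulmx1 mulmxA.
  rewrite mul_mx_adj mulmxBl raddfB /= -mulmxA mul_scalar_mx mxtraceZ.
  by rewrite -adjM_mx2 mxtrace_adj_mx2 mxtrace_mulC.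
by rewrite detD_mx2 det_mulmx detXA1 trA; ring.
Qed.

End Matrix2.

Theorem theorem5 (R : comPzRingType) (A : 'M[R]_2) :
  left_stable_range1 A <->
  forall X : 'M[R]_2, exists Y : 'M[R]_2,
    is_unit (\det Y * (\det X * \det A - \tr (X *m A) + 1)
             + \det A * (\tr (X *m Y) + 1)
             - \tr (A *m \adj Y)).
Proof.
apply: (iff_trans (left_stable_range1_subr1P A)).
split=> unitA X; have [Y unitY] := unitA X; exists Y.
  by rewrite -det_addM_subr1; apply: (is_unit_detP _).1 unitY.
by apply: (is_unit_detP _).2; rewrite det_addM_subr1.
Qed.
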